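(* Let $n,m\ge 1$ be integers, let $\Delta_1,\dots,\Delta_m\subseteq[n]$ be cliques covering $[n]$, none of which is contained in another, let $\mathbf g_i:\mathbb R^{|\Delta_i|}\to\mathbb R^{N_i}$ ($i\in[m]$, $N_i\in\mathbb N$) be vectors of polynomials, and let $\omega\in\mathbb N$ satisfy $2\omega\ge\max\{1,\deg\mathbf g_1,\dots,\deg\mathbf g_m\}$. Let $K=\{\mathbf x\in\mathbb R^n:\ \mathbf g_i(\mathbf x_{\Delta_i})\ge 0\ \ \forall i\in[m]\}$ and $d_i=\max\{1,\lceil\tfrac12\deg\mathbf g_i\rceil\}$. Let $\mathbf y=(y_\alpha)_{\alpha\in\mathcal E_{2\omega}}$ be a nonzero real vector. Assume that: (a) the cliques $\Delta_1,\dots,\Delta_m$ satisfy the running intersection property: for every $i\in\{2,\dots,m\}$ there exists $j\in[i-1]$ such that $\Delta_i\cap(\Delta_1\cup\dots\cup\Delta_{i-1})\subseteq\Delta_j$; (b) for every $i\in[m]$, $$\mathbb M^\omega_{\Delta_i}(\mathbf y)\succeq0,\qquad \mathbb M^\omega_{\Delta_i}(\mathbf g_i\mathbf y)\succeq0,\qquad \operatorname{rank}\mathbb M^\omega_{\Delta_i}(\mathbf y)=\operatorname{rank}\mathbb M^{\omega-d_i}_{\Delta_i}(\mathbf y),$$ and, for every $i\in\{2,\dots,m\}$, there exists $j\in[i-1]$ with $\Delta_i\cap(\Delta_1\cup\dots\cup\Delta_{i-1})\subseteq\Delta_j$ such that $$\operatorname{rank}\mathbb M^\omega_{\Delta_i\cap\Delta_j}(\mathbf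 y)=\operatorname{rank}\mathbb M^{\omega-1}_{\Delta_i\cap\Delta_j}(\mathbf y).$$ Then there exist an integer $r\ge\max_{i\in[m]}\operatorname{rank}\mathbb M^\omega_{\Delta_i}(\mathbf y)$, pairwise distinct points $\mathbf x_1,\dots,\mathbf x_r\in K$, and scalars $\lambda_1,\dots,\lambda_r>0$ such that the atomic measure $\lambda_1\delta_{\mathbf x_1}+\dots+\lambda_r\delta_{\mathbf x_r}$ represents $\mathbf y$. In particular, $$y_\alpha=\lambda_1\mathbf x_1^\alpha+\dots+\lambda_r\mathbf x_r^\alpha\qquad\text{for all }\alpha\in\mathcal E_{2\omega}.$$
   Context: Notation: $\mathbb N=\{0,1,2,\dots\}$, $[k]=\{1,\dots,k\}$. For $\Delta\subseteq[n]$, $\mathbf x_\Delta$ is the subvector of $\mathbf x\in\mathbb R^n$ indexed by $\Delta$. Vector inequalities are element-wise; $\deg\mathbf g_i$ is the maximum degree of the entries of $\mathbf g_i$ (and $0$ if $N_i=0$); $\succeq0$ means positive semidefinite. $\delta_{\mathbf x}$ is the Dirac measure at $\mathbf x$. Correlatively sparse multi-indices: $\mathcal E_{2\omega}=\bigcup_{i=1}^m\{\alpha\in\mathbb N^n:\ \alpha_k=0\ \forall k\notin\Delta_i,\ \alpha_1+\dots+\alpha_n\le2\omega\}$. Riesz functional: $\mathscr L_{\mathbf y}$ is the linear functional on $\operatorname{span}\{\mathbf x^\alpha:\alpha\in\mathcal E_{2\omega}\}$ with $\mathscr L_{\mathbf y}(\mathbf x^\alpha)=y_\alpha$. Moment matrices: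 for $\Delta\subseteq[n]$ contained in some clique and $0\le d\le\omega$, $\mathbb M^d_\Delta(\mathbf y)$ is the matrix with rows and columns indexed by the monomials in the variables $\mathbf x_\Delta$ of total degree at most $d$, whose $(p,q)$ entry is $\mathscr L_{\mathbf y}(pq)$. In particular $\mathbb M^\omega_{\Delta_i\cap\Delta_j}(\mathbf y)$ is the largest common principal submatrix (up to symmetric permutation) of $\mathbb M^\omega_{\Delta_i}(\mathbf y)$ and $\mathbb M^\omega_{\Delta_j}(\mathbf y)$. Localizing matrices: $\mathbb M^\omega_{\Delta_i}(\mathbf g_i\mathbf y)$ is the block-diagonal matrix with blocks $\mathbb M^\omega_{\Delta_i}(g_{i,k}\mathbf y)$, $k\in[N_i]$, where $\mathbb M^\omega_{\Delta_i}(g_{i,k}\mathbf y)$ is indexed by the monomials in $\mathbf x_{\Delta_i}$ of degree at most $\omega-d_i$ and has $(p,q)$ entry $\mathscr L_{\mathbf y}(g_{i,k}(\mathbf x_{\Delta_i})\,pq)$. A positive Borel measure $\mu$ on $\mathbb R^n$ represents $\mathbf y$ if $\int\mathbf x^\alpha\,d\mu=y_\alpha$ for all $\alpha\in\mathcal E_{2\omega}$. *)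

(* Defs.v *)
From HB Require Import structures.
From mathcomp Require Import all_boot all_order all_algebra.
From mathcomp Require Import all_classical all_reals all_analysis.
From mathcomp Require mpoly.
(* The notations of mpoly clash with those of mathcomp-analysis. *)
Import -(notations) mpoly.

Set Implicit Arguments.
Unset Strict Implicit.
Unset Printing Implicit Defensive.

Import Order.TTheory GRing.Theory Num.Theory.

Local Open Scope classical_set_scope.
Local Open Scope ring_scope.

(* R^n.  The sigma-algebra on tuples is the product of the Borel
   sigma-algebras of the factors, which is the Borel sigma-algebra of R^n. *)
Notation euclid R n := (n.-tuple (measurableTypeR R)).

Section Monomials.
Variable n : nat.

Definition supported_in (A : {set 'I_n}) (a : multinom n) : bool :=
  [forall k : 'I_n, (k \notin A) ==> (a k == 0%N)].

Definition monomials (A : {set 'I_n}) (d : nat) : finType :=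
  {a : bmultinom n d.+1 | supported_in A (val a)}.

Definition cs_index (m : nat) (D : 'I_m -> {set 'I_n}) (w : nat) : finType :=
  {a : bmultinom n (2 * w).+1 | [exists i : 'I_m, supported_in (D i) (val a)]}.

Variable R : realType.

Definition monom_eval (x : euclid R n) (a : multinom n) : R :=
  \prod_(k < n) tnth x k ^+ a k.

Definition subvec (A : {set 'I_n}) (x : euclid R n) : #|A|.-tuple R :=
  [tuple tnth x (enum_val k) | k < #|A|].

(* g(x_A) as a polynomial in all the variables x. *)
Definition lift_poly (A : {set 'I_n}) (g : mpoly #|A| R) : mpoly n R :=
  comp_mpoly [tuple mpolyX R (mnm1 (enum_val k)) | k < #|A|] g.

End Monomials.

(* The maximum over the empty family is 0, and so is the degree of the zero
   polynomial. *)
Definition max_deg (R : realType) (p N : nat) (g : 'I_N -> mpoly p R) : nat :=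
  \max_(k < N) (mmeasure mdeg (g k)).-1.

Definition half_deg (R : realType) (p N : nat) (g : 'I_N -> mpoly p R) : nat :=
  maxn 1 (uphalf (max_deg g)).

Definition psd (R : realType) (N : nat) (A : 'M[R]_N) : Prop :=
  A^T = A /\ forall v : 'cV[R]_N, 0 <= (v^T *m A *m v) 0 0.

Section Moments.
Variables (R : realType) (n m : nat) (D : 'I_m -> {set 'I_n}) (w : nat).
Variable y : {ffun cs_index D w -> R}.

(* Only meant for polynomials in the span of the monomials indexed by
   cs_index D w; the other coefficients of p are ignored. *)
Definition riesz (p : mpoly n R) : R :=
  \sum_(a : cs_index D w) mcoeff (val (val a)) p * y a.

Definition moment_mx (A : {set 'I_n}) (d : nat) : 'M[R]_#|monomials A d| :=
  \matrix_(p, q) riesz (mpolyX R (val (val (enum_val p))) *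
                        mpolyX R (val (val (enum_val q)))).

Definition localizing_block (A : {set 'I_n}) (d : nat) (g : mpoly #|A| R) :
    'M[R]_#|monomials A d| :=
  \matrix_(p, q) riesz (lift_poly g *
                        mpolyX R (val (val (enum_val p))) *
                        mpolyX R (val (val (enum_val q)))).

Definition localizing_mx (A : {set 'I_n}) (N : nat)
    (g : 'I_N -> mpoly #|A| R) :=
  \mxdiag_(k < N) localizing_block (w - half_deg g) (g k).

(* The moments are finite, so the equality entails that the monomials are
   integrable: in \bar R, (+oo) - (+oo) is infinite. *)
Definition represents (mu : {measure set (euclid R n) -> \bar R}) : Prop :=
  forall a : cs_index D w,
    (\int[mu]_x (monom_eval x (val (val a)))%:E = (y a)%:E)%E.

End Moments.

Definition feasible_set (R : realType) (n m : nat) (D : 'I_m -> {set 'I_n})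
    (N : 'I_m -> nat) (g : forall i : 'I_m, 'I_(N i) -> mpoly #|D i| R) :
    set (euclid R n) :=
  [set x | forall (i : 'I_m) (k : 'I_(N i)),
             0 <= meval (tnth (subvec (D i) x)) (g i k)].

Section AtomicMeasure.
Variables (R : realType) (d : measure_display) (T : measurableType d).
Variables (r : nat) (x : 'I_r -> T) (l : 'I_r -> {posnum R}).

Definition atomic_measure (A : set T) : \bar R :=
  (\sum_(k < r) (l k)%:num%:E * \d_(x k) A)%E.

Let atomic_measure0 : atomic_measure set0 = 0%E.
Proof. by rewrite /atomic_measure big1// => k _; rewrite measure0 mule0. Qed.

Let atomic_measure_ge0 A : (0 <= atomic_measure A)%E.
Proof. by apply: sume_ge0 => k _; rewrite mule_ge0. Qed.

Let atomic_measure_sigma_additive : semi_sigma_additive atomic_measure.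
Proof.
move=> F mF tF mUF; rewrite /atomic_measure.
have l_ge0 i : 0 <= (l i)%:num by [].
pose mu (k : nat) : {measure set T -> \bar R} :=
  if insub k is Some i then mscale (NngNum (l_ge0 i)) \d_(x i)
  else mzero.
have E A : (\sum_(k < r) (l k)%:num%:E * \d_(x k) A)%E = msum mu r A.
  by apply: eq_bigr => k _; rewrite /mu valK.
under eq_fun do under eq_bigr do rewrite E.
by rewrite E; exact: measure_semi_sigma_additive.
Qed.

HB.instance Definition _ := measure_function.isMeasure.Build _ _ _
  atomic_measure atomic_measure0 atomic_measure_ge0
  atomic_measure_sigma_additive.

End AtomicMeasure.

(* Main.v *)
Require Import Defs.
From HB Require Import structures.
From mathcomp Require Import all_boot all_order all_algebra.
From mathcomp Require Import complex ring lra zify.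
From mathcomp Require Import all_classical all_reals all_analysis.
From mathcomp Require Import measurable_realfun.
From mathcomp Require mpoly.
Import -(notations) mpoly.

(* On one clique, flatness makes multiplication by a variable well defined on
   polynomials modulo the kernel of the moment matrix; these operators commute
   and are self-adjoint for the moment form, so they can be diagonalized
   simultaneously over the reals, and the joint eigenvalues are the atoms
   (Curto and Fialkow).  Testing the localizing form on a polynomial that
   vanishes at all atoms but one shows that each atom is feasible.  Two clique
   measures have the same marginal on a flat overlap, because modulo polynomials
   vanishing at the atoms every polynomial in the shared variables has low
   degree, so all the moments of the marginals are determined by [y].  Along the
   running intersection order the clique measures are then glued by the
   conditional product over the common marginal.  The rank bound holds for every
   representing measure: a moment matrix is a sum of [r] matrices of rank 1. *)

Set Implicit Arguments.
Unset Strict Implicit.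
Unset Printing Implicit Defensive.

Import Order.TTheory GRing.Theory Num.Theory.

Local Open Scope ring_scope.

(** * Real linear algebra: diagonalization and semidefinite forms *)

(** Over the algebraically closed [R[i]], a nonreal root [a + bi] forces the real quadratic
    [(X - a)^2 + b^2] to divide [p]: the remainder has degree at most 1 and real coefficients, so it
    can vanish at a nonreal point only if it is 0. *)
Lemma real_rooted_split (R : rcfType) (p : {poly R}) : p \is monic ->
  (forall a b, b != 0 -> ~~ (('X - a%:P) ^+ 2 + (b ^+ 2)%:P %| p)) ->
  exists rs, p = \prod_(a <- rs) ('X - a%:P).
Proof.
move=> pm pN; pose C := real_complex R.
have [zs pE] := closed_field_poly_normal (map_poly C p).
move: pE; rewrite lead_coef_map (monicP pm) rmorph1 scale1r => pE.
have zsR z : z \in zs -> z = C (complex.Re z).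
  move=> zzs; apply/eqP; rewrite eq_complex /= eqxx /=; apply: contraT => b0.
  
  case: z zzs b0 => a b /= zzs b0.
  have := pN a b b0; set q := (_ + _ : {poly R}).
  have sq : size q = 3.
    rewrite /q size_polyDl size_exp_XsubC// size_polyC; by case: eqP.
  have rz : root (map_poly C p) (Complex a b) by rewrite pE root_prod_XsubC.
  have rq : root (map_poly C q) (Complex a b).
    rewrite /q rmorphD rmorphXn /= rmorphB /= map_polyX !map_polyC /= /root.
    rewrite !hornerE /= /C expr2; apply/eqP/eqP.
    rewrite eq_complex /= subrr !(mul0r, mulr0) addr0 ?add0r ?sub0r. apply/andP; split=> //.
    by rewrite subr0 expr2 addNr.
  suff : p %% q = 0 by move=> /eqP; rewrite -/(dvdp _ _) => ->.
  have : root (map_poly C (p %% q)) (Complex a b).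
    move: rz; rewrite {1}(divp_eq p q) rmorphD rmorphM /= /root hornerD hornerM.
    by rewrite (rootP rq) mulr0 add0r.
  have sr : (size (p %% q)%R <= 2)%N.
    have := ltn_modp p q; rewrite -size_poly_eq0 sq; exact.
  have -> : p %% q = (p %% q)`_1 *: 'X + ((p %% q)`_0)%:P.
    apply/polyP => i; rewrite !(coefE, coefC); case: i => [|[|i]] //=; rewrite ?mulr0 ?mulr1 ?add0r ?addr0//.
    by rewrite nth_default// (leq_trans sr).
  set u := _`_1; set v := _`_0.
  rewrite rmorphD /= map_polyZ map_polyX map_polyC /= /root !hornerE /= /C.
  rewrite eq_complex /= !(mul0r, mulr0, addr0, subr0) => /andP[/eqP h1 /eqP h2].
  have u0 : u = 0 by apply/eqP; move/eqP: h2; rewrite mulf_eq0 (negPf b0) orbF.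
  move: h1; rewrite u0 mul0r add0r => ->.
  by rewrite scale0r add0r.
exists (map (@complex.Re R) zs).
apply: (@map_poly_inj _ _ (real_complex R)).
rewrite [LHS]pE rmorph_prod big_map /=.
apply: eq_big_seq => z /zsR zE.
by rewrite rmorphB /= map_polyX map_polyC /= {1}zE.
Qed.

(** [X] is self-adjoint for the inner product [u *m S *m v^T] on rows. Hence its minimal polynomial
    has neither an irreducible quadratic factor nor a repeated root, and splits into distinct real
    linear factors. *)
Lemma self_adjoint_diagonalizable (R : rcfType) (r : nat) (S X : 'M[R]_r) :
  S^T = S -> (forall u : 'rV_r, u != 0 -> 0 < (u *m S *m u^T) 0 0) ->
  X *m S = S *m X^T -> diagonalizable X.
Proof.
case: r S X => [|r] S X SS Sp XS; first by rewrite [X]thinmx0; exact: diagonalizable0.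
have Sge0 (u : 'rV_r.+1) : 0 <= (u *m S *m u^T) 0 0.
  have [->|/Sp/ltW//] := eqVneq u 0; by rewrite !mul0mx mxE.
have adj a (u v : 'rV_r.+1) :
    u *m (X - a%:M) *m S *m v^T = u *m S *m (v *m (X - a%:M))^T.
  have -> : (v *m (X - a%:M))^T = (X^T - a%:M) *m v^T.
    by rewrite trmx_mul linearB /= tr_scalar_mx.
  by rewrite !mulmxA -!(mulmxA u) mulmxBl mulmxBr XS scalar_mxC.
have sq a (u : 'rV_r.+1) : u *m (X - a%:M) *m (X - a%:M) *m S *m u^T =
    (u *m (X - a%:M)) *m S *m (u *m (X - a%:M))^T by rewrite adj.
(* The squared norm of [u *m (X - a%:M)] would be [- b ^+ 2] times that of [u]. *)
have inj a b (u : 'rV_r.+1) : b != 0 ->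
    u *m (X - a%:M) *m (X - a%:M) = - (b ^+ 2 *: u) -> u = 0.
  move=> b0 E; apply/eqP; apply: contraT => u0.
  have := Sge0 (u *m (X - a%:M)); rewrite -sq E !mulNmx -!scalemxAl 2!mxE.
  by rewrite oppr_ge0 leNgt mulr_gt0 ?Sp// exprn_even_gt0.
have red a (u : 'rV_r.+1) : u *m (X - a%:M) *m (X - a%:M) = 0 -> u *m (X - a%:M) = 0.
  move=> E; apply/eqP; apply: contraT => /Sp; rewrite -sq E !mul0mx mxE.
  by rewrite ltxx.
have hX a : horner_mx X ('X - a%:P) = X - a%:M.
  by rewrite rmorphB /= horner_mx_X horner_mx_C.
set p := mxminpoly X; have pm : p \is monic := mxminpoly_monic X.
have p0 : p != 0 by rewrite monic_neq0.
(* Minimality of [p]: a cofactor [q] cannot be replaced by a shorter [q']. *)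
have smaller (h q q' : {poly R}) : p = h * q -> q' != 0 ->
    horner_mx X (h * q') = 0 -> (size q <= size q')%N.
  move=> pE q'0 /mxminpoly_min; rewrite -/p pE.
  have h0 : h != 0 by apply: contraNneq p0 => h0; rewrite pE h0 mul0r.
  by rewrite dvdp_mul2l// => qq'; exact: dvdp_leq.
have [] := @real_rooted_split _ p pm.
  move=> a b b0; apply/negP => /dvdpP[h pE].
  have : horner_mx X (h * 1) = 0.
    rewrite mulr1; apply/row_matrixP => i; rewrite row0; apply: (inj a b) => //.
    apply/eqP; rewrite -addr_eq0; apply/eqP.
    have : row i (horner_mx X p) = 0 by rewrite mx_root_minpoly row0.
    rewrite pE rmorphM rmorphD rmorphXn /= hX horner_mx_C -mulmxE row_mul mulmxDr.
    by rewrite mul_mx_scalar expr2 -mulmxE mulmxA.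
  move=> /(smaller _ _ _ pE (oner_neq0 _)).
  rewrite size_polyDl size_exp_XsubC ?size_poly1// size_polyC; by case: eqP.
move=> rs pE; apply/diagonalizableP; exists rs; last by rewrite -pE.
(* A repeated entry [a] of [rs] gives [p = h * ('X - a%:P) ^+ 2]; by [red], [h * ('X - a%:P)]
   annihilates [X] already. *)
apply/negPn/negP => /uniqPn -/(_ 0)[i [j [ij js E]]].
pose a := rs`_j.
have ars : a \in rem a rs.
  rewrite -has_pred1 has_count count_rem mem_nth//= eqxx /=.
  have : (1 < count_mem a rs)%N.
    rewrite -(cat_take_drop j rs) count_cat (drop_nth 0)//= eqxx addnCA.
    rewrite ltnS addn_gt0 -has_count has_pred1.
    by rewrite /a -E -(nth_take 0 ij) mem_nth// size_take js.
  by case: (count _ _) => [|[]].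
have := perm_to_rem (mem_nth 0 js); rewrite -/a => P1.
have := perm_to_rem ars => P2.
pose h := \prod_(x <- rem a (rem a rs)) ('X - x%:P).
have pE' : p = h * ('X - a%:P) ^+ 2.
  rewrite pE (perm_big _ P1) big_cons (perm_big _ P2) big_cons /= -/h mulrA mulrC.
  by rewrite expr2.
suff /(smaller _ _ _ pE') : horner_mx X (h * ('X - a%:P)) = 0.
  by rewrite polyXsubC_eq0 size_exp_XsubC size_XsubC => /(_ isT).
apply/row_matrixP => k; rewrite row0 rmorphM /= hX -mulmxE row_mul.
apply: red; have : row k (horner_mx X p) = 0 by rewrite mx_root_minpoly row0.
by rewrite pE' rmorphM rmorphXn /= hX -mulmxE row_mul expr2 -mulmxE mulmxA.
Qed.

(** A maximal free family of rows spans the row space; by symmetry the columns with the same indices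
    span the column space, so their intersection keeps the full rank. *)
Lemma sym_principal_unit (F : fieldType) (N : nat) (M : 'M[F]_N) : M^T = M ->
  exists f : 'I_(\rank M) -> 'I_N, mxsub f f M \in unitmx.
Proof.
move=> Msym; exists (maxrankfun M); set f := maxrankfun M.
have /submxP[W WE] : (M <= rowsub f M)%MS by rewrite eq_maxrowsub.
have rowE : rowsub f M = (W *m mxsub f f M)^T.
  have -> : mxsub f f M = colsub f (rowsub f M) by apply/matrixP=> i j; rewrite !mxE.
  by rewrite mulmx_colsub -WE trmx_mxsub Msym.
rewrite -row_full_unit /row_full eqn_leq rank_leq_row /=.
have : (\rank (rowsub f M) <= \rank (mxsub f f M))%N.
  by rewrite rowE mxrank_tr mxrankM_maxr.
by have /eqP -> := maxrowsub_free M.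
Qed.

(** The selected rows contain an invertible block of size [r], so they have rank [r] and span all
    rows of [M]. *)
Lemma principal_unit_row_factor (F : fieldType) (N r : nat) (M : 'M[F]_N)
    (f : 'I_r -> 'I_N) :
  mxsub f f M \in unitmx -> (\rank M <= r)%N ->
  exists C : 'M[F]_(N, r), M = C *m rowsub f M.
Proof.
move=> Mu rM; apply/submxP.
have le1 : (rowsub f M <= M)%MS by exact: rowsub_sub.
rewrite -(geq_leqif (mxrank_leqif_sup le1)) (leq_trans rM)//.
rewrite -{1}(mxrank_unit Mu) -(mulmx1 (rowsub f M)).
have -> : mxsub f f M = rowsub f M *m colsub f 1%:M.
  by rewrite mulmx_colsub mulmx1; apply/matrixP=> i j; rewrite !mxE.
by rewrite mulmx1 mxrankM_maxl.
Qed.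

(** If [u] is isotropic, the form at [v + t *: u] is affine in [t] and nonnegative, hence constant.
    So [u] lies in the radical, which is trivial. *)
Lemma sym_form_pos_def (R : realFieldType) (r : nat) (G : 'M[R]_r) :
  G^T = G -> G \in unitmx -> (forall u : 'rV_r, 0 <= (u *m G *m u^T) 0 0) ->
  forall u : 'rV_r, u != 0 -> 0 < (u *m G *m u^T) 0 0.
Proof.
move=> GT Gu Gp u u0; rewrite lt_neqAle Gp andbT eq_sym.
apply: contraNneq u0 => uGu0.
suff uG (v : 'rV_r) : (u *m G *m v^T) 0 0 = 0.
  rewrite -(mulmxK Gu u) (_ : u *m G = 0) ?mul0mx//.
  by apply/rowP => j; rewrite [RHS]mxE -(uG (delta_mx 0 j)) trmx_delta -colE [RHS]mxE.
have sym : (v *m G *m u^T) 0 0 = (u *m G *m v^T) 0 0.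
  by rewrite -[in LHS]GT -(trmxK v) -!trmx_mul mulmxA mxE trmxK.
have entry (A B C E : 'M[R]_1) t : (A + t *: B + t *: C + t ^+ 2 *: E) 0 0 =
    A 0 0 + t * B 0 0 + t * C 0 0 + t ^+ 2 * E 0 0 by rewrite !mxE.
have quad t : 0 <= (v *m G *m v^T) 0 0 + 2 * t * (u *m G *m v^T) 0 0.
  have := Gp (v + t *: u).
  have -> : (v + t *: u) *m G *m (v + t *: u)^T = v *m G *m v^T +
      t *: (v *m G *m u^T) + t *: (u *m G *m v^T) + t ^+ 2 *: (u *m G *m u^T).
    rewrite linearD /= linearZ /= !(mulmxDl, mulmxDr) -!scalemxAl -!scalemxAr.
    by rewrite scalerA !addrA -expr2.
  rewrite entry uGu0 sym.
  by rewrite mulr0 addr0 -addrA -mulrDl -mulr2n mulr_natl.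
set q := (v *m G *m v^T) 0 0 in quad; set b := (u *m G *m v^T) 0 0 in quad *.
apply/eqP; apply: contraT => b0.
(* At this [t] the affine function takes the value -1. *)
have := quad (- (q + 1) / (2 * b)).
rewrite (_ : 2 * _ * b = - (q + 1)); last by field.
by lra.
Qed.

(** * Monomials supported on a set of variables *)

Local Notation "a +m b" := (mnm_add a b) (at level 50, left associativity).
Local Notation m1 := mnm1.

Section SparseMonomials.
Variable n : nat.
Implicit Types (A B : {set 'I_n}) (a b c : multinom n).

(** The predicate behind the index type [monomials]; it lets supports and degrees vary without casts
    between finite types. *)
Definition in_mon A d a := supported_in A a && (mdeg a <= d)%N.

Lemma in_mon0 A d : in_mon A d (@mnm0 n).
Proof. by rewrite /in_mon mdeg0 andbT; apply/forallP => k; rewrite mnm0E eqxx implybT. Qed.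

Lemma in_mon1 A d k : k \in A -> in_mon A d.+1 (m1 k).
Proof.
move=> kA; rewrite /in_mon mdeg1 andbT; apply/forallP => j; rewrite mnm1E eqb0.
by apply/implyP; apply: contraNneq => <-.
Qed.

Lemma in_monD A d e a b : in_mon A d a -> in_mon A e b -> in_mon A (d + e) (a +m b).
Proof.
move=> /andP[/forallP aA ad] /andP[/forallP bA be]; rewrite /in_mon mdegD leq_add// andbT.
apply/forallP => k; apply/implyP => kA; rewrite mnmDE.
by rewrite (eqP (implyP (aA k) kA)) (eqP (implyP (bA k) kA)).
Qed.

Lemma in_mon_sub A B d e a : A \subset B -> (d <= e)%N -> in_mon A d a -> in_mon B e a.
Proof.
move=> AB de /andP[/forallP aA ad]; rewrite /in_mon (leq_trans ad)// andbT.
apply/forallP => k; apply/implyP => kB; apply: (implyP (aA k)).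
by apply: contraNN kB => /(fintype.subsetP AB).
Qed.

Lemma in_mon_le A d e a : (d <= e)%N -> in_mon A d a -> in_mon A e a.
Proof. exact: in_mon_sub. Qed.

Lemma in_monI A B d a : in_mon (A :&: B) d a = in_mon A d a && in_mon B d a.
Proof.
apply/idP/andP => [aAB|[/andP[/forallP aA ad] /andP[/forallP aB _]]].
  by split; apply: in_mon_sub aAB => //; rewrite (subsetIl, subsetIr).
rewrite /in_mon ad andbT; apply/forallP => k; rewrite inE negb_and.
by apply/implyP => /orP[] kN; [apply: (implyP (aA k))|apply: (implyP (aB k))].
Qed.

Lemma in_mon_pred A d a : in_mon A d a -> a != @mnm0 n ->
  exists k b, [/\ k \in A, a = m1 k +m b & in_mon A d.-1 b].
Proof.
move=> /andP[/forallP aA ad] a0.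
have [k ak] : exists k, a k != 0%N.
  apply/existsP; apply: contraNT a0 => /existsPn a0.
  by apply/eqP/mnmP => k; rewrite mnm0E; apply/eqP/negPn/a0.
have kA : k \in A by apply: contraNT ak => /(implyP (aA k)).
have aE : a = m1 k +m mnm_sub a (m1 k).
  apply/mnmP => j; rewrite mnmDE mnmBE mnm1E.
  by case: eqP => [<-|_]; rewrite ?subnKC ?lt0n ?subn0.
exists k, (mnm_sub a (m1 k)); split=> //.
apply/andP; split.
  apply/forallP => j; apply/implyP => /(implyP (aA j)); rewrite mnmBE.
  by move=> /eqP ->; rewrite sub0n.
by move: ad; rewrite {1}aE mdegD mdeg1; case: d {aA}.
Qed.

Lemma in_mon_split A d e a : in_mon A (d + e) a ->
  exists b c, [/\ a = b +m c, in_mon A d b & in_mon A e c].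
Proof.
elim: d a => [|d IH] a aA.
  by exists (@mnm0 n), a; rewrite in_mon0; split=> //; apply/mnmP => k; rewrite mnmDE mnm0E.
have [->|a0] := eqVneq a (@mnm0 n).
  exists (@mnm0 n), (@mnm0 n); rewrite !in_mon0; split=> //.
  by apply/mnmP => k; rewrite mnmDE mnm0E.
have [k [a' [kA -> /IH[b [c [-> bA cA]]]]]] := in_mon_pred aA a0.
exists (m1 k +m b), c; split=> //; first by apply/mnmP => j; rewrite !mnmDE addnA.
by rewrite -add1n; exact: in_monD (in_mon1 _ kA) bA.
Qed.

(** The step is asked only for [a] of degree at most [d], the range in which multiplying by one more
    variable stays within degree [d.+1]. *)
Lemma in_mon_ind A d (P : multinom n -> Prop) : P (@mnm0 n) ->
  (forall k a, k \in A -> in_mon A d a -> P a -> P (m1 k +m a)) ->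
  forall a, in_mon A d.+1 a -> P a.
Proof.
move=> P0 PS; suff PA e : (e <= d.+1)%N -> forall a, in_mon A e a -> P a.
  exact: (PA d.+1).
elim: e => [_|e IH ed] a.
  by move=> /andP[_]; rewrite leqn0 mdeg_eq0 => /eqP ->.
have [->//|a0] := eqVneq a (@mnm0 n).
move=> /in_mon_pred /(_ a0)[k [b [kA -> bA]]].
by apply: PS => //; [exact: in_mon_le bA | apply: IH bA; exact: ltnW].
Qed.

Lemma monomials_in_mon A d (p : monomials A d) : in_mon A d (val (val p)).
Proof. by rewrite /in_mon (valP p) /= -ltnS bmdeg. Qed.

Lemma in_mon_monomials A d a : in_mon A d a -> exists p : monomials A d, a = val (val p).
Proof.
move=> /andP[aA]; rewrite -ltnS => ad.
by exists (exist _ (BMultinom ad) aA).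
Qed.

Variable R : comNzRingType.
Implicit Types x : 'I_n -> R.

Definition mev x a : R := \prod_(k < n) x k ^+ a k.

Lemma mevD x a b : mev x (a +m b) = mev x a * mev x b.
Proof. by rewrite -big_split; apply: eq_bigr => k _; rewrite mnmDE exprD. Qed.

Lemma mev0 x : mev x (@mnm0 n) = 1.
Proof. by rewrite /mev big1// => k _; rewrite mnm0E. Qed.

Lemma mev1 x k : mev x (m1 k) = x k.
Proof.
rewrite /mev (bigD1 k)//= mnm1E eqxx expr1 big1 ?mulr1// => j jk.
by rewrite mnm1E eq_sym (negPf jk).
Qed.

Lemma eq_mev A d x z a : in_mon A d a -> {in A, x =1 z} -> mev x a = mev z a.
Proof.
move=> /andP[/forallP aA _] xz; apply: eq_bigr => k _.
by have [/xz ->//|/(implyP (aA k))/eqP ->] := boolP (k \in A).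
Qed.

End SparseMonomials.

(** * Flat moment matrices and their atoms *)

Lemma psd_mxsub (R : realType) (N r : nat) (M : 'M[R]_N) (f : 'I_r -> 'I_N) :
  psd M -> psd (mxsub f f M).
Proof.
move=> [MT Mp]; split=> [|v]; first by rewrite trmx_mxsub MT.
have -> : mxsub f f M = rowsub f 1%:M *m M *m (rowsub f 1%:M)^T.
  rewrite mul_rowsub_mx mul1mx trmx_mxsub trmx1 mulmx_colsub mulmx1.
  by apply/matrixP => i j; rewrite !mxE.
by have := Mp ((rowsub f 1%:M)^T *m v); rewrite trmx_mul trmxK !mulmxA.
Qed.

Section FlatExtension.
Variables (R : realType) (n : nat) (Y : multinom n -> R).
Implicit Types (A : {set 'I_n}) (a : multinom n).

(** [Y] is a function on all monomials, so that no membership in the index set has to be carried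
    along. *)
Definition mnm_moment_mx A d : 'M[R]_#|monomials A d| :=
  \matrix_(p, q) Y (val (val (enum_val p)) +m val (val (enum_val q))).

Definition gram_mx r (b : 'I_r -> multinom n) : 'M[R]_r := \matrix_(s, t) Y (b s +m b t).

Lemma gram_mx_sym r (b : 'I_r -> multinom n) : (gram_mx b)^T = gram_mx b.
Proof. by apply/matrixP => s t; rewrite !mxE addmC. Qed.

Lemma gram_mxE A d r (b : 'I_r -> multinom n) : (forall t, in_mon A d (b t)) ->
  exists f, gram_mx b = mxsub f f (mnm_moment_mx A d).
Proof.
move=> bA; have {}bA t := cid (in_mon_monomials (bA t)).
exists (fun t => enum_rank (projT1 (bA t))); apply/matrixP => s t.
by rewrite !mxE !enum_rankK -!(projT2 (bA _)).
Qed.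

Lemma gram_mx_ge0 A d r (b : 'I_r -> multinom n) (u : 'rV_r) :
  psd (mnm_moment_mx A d) -> (forall t, in_mon A d (b t)) ->
  0 <= (u *m gram_mx b *m u^T) 0 0.
Proof.
move=> Mp /gram_mxE[f ->]; have [_ /(_ u^T)] := psd_mxsub f Mp.
by rewrite trmxK.
Qed.

(** An invertible principal block of the smaller matrix, of size its rank, has by flatness the size
    of the rank of the larger one, so its rows span there too. The last clause says that every
    monomial is a combination of the [b t] modulo the kernel. *)
Lemma flat_basis A e w : (e <= w)%N ->
  \rank (mnm_moment_mx A w) = \rank (mnm_moment_mx A e) ->
  exists r (b : 'I_r -> multinom n),
    [/\ forall t, in_mon A e (b t), gram_mx b \in unitmx &
        forall a, in_mon A w a -> exists c : 'rV_r, forall a', in_mon A w a' ->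
          Y (a +m a') = \sum_t c 0 t * Y (b t +m a')].
Proof.
move=> ew rkE; set M := mnm_moment_mx A w.
have : (mnm_moment_mx A e)^T = mnm_moment_mx A e.
  by apply/matrixP => s t; rewrite !mxE addmC.
move=> /sym_principal_unit[f fu]; set r := \rank _ in f fu.
pose b t := val (val (enum_val (f t))) : multinom n.
have bA t : in_mon A e (b t) by exact: monomials_in_mon.
have bu : gram_mx b \in unitmx.
  have -> // : gram_mx b = mxsub f f (mnm_moment_mx A e).
  by apply/matrixP => s t; rewrite !mxE.
exists r, b; split=> // a aA.
have {}bA t : in_mon A w (b t) := in_mon_le ew (bA t).
have {}bA t := cid (in_mon_monomials (bA t)).
pose h t := enum_rank (projT1 (bA t)).
have hE t : val (val (enum_val (h t))) = b t by rewrite enum_rankK -(projT2 (bA t)).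
have Mu : mxsub h h M \in unitmx.
  have -> // : mxsub h h M = gram_mx b.
  by apply/matrixP => s t; rewrite !mxE !hE.
have [C MC] := principal_unit_row_factor Mu (eq_leq rkE).
have [p pE] := in_mon_monomials aA.
exists (row (enum_rank p) C) => a' /in_mon_monomials[q qE].
have := congr1 (fun X : 'M[R]_#|monomials A w| => X (enum_rank p) (enum_rank q)) MC.
rewrite !mxE !enum_rankK -pE -qE => ->; apply: eq_bigr => t _.
by rewrite !mxE hE enum_rankK -qE.
Qed.

(* Curto and Fialkow's flat extension theorem.  The last property provides, for
   each atom, a polynomial in the basis monomials that vanishes at the other
   atoms. *)
Lemma flat_extension A w r (b : 'I_r -> multinom n) :
  psd (mnm_moment_mx A w.+1) ->
  (forall t, in_mon A w (b t)) -> gram_mx b \in unitmx ->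
  (forall a, in_mon A w.+1 a -> exists c : 'rV_r, forall a', in_mon A w.+1 a' ->
     Y (a +m a') = \sum_t c 0 t * Y (b t +m a')) ->
  exists (x : 'I_r -> 'I_n -> R) (l : 'I_r -> R), [/\ forall s, 0 < l s,
    forall a, in_mon A (w.+1 + w.+1) a -> Y a = \sum_s l s * mev (x s) a &
    forall s, exists v : 'I_r -> R, forall t,
      \sum_u v u * mev (x t) (b u) = (t == s)%:R].
Proof.
move=> Mp bA Gu red; set G := gram_mx b.
have GT : G^T = G := gram_mx_sym b.
have bA1 t : in_mon A w.+1 (b t) := in_mon_le (leqnSn w) (bA t).
have Gp := sym_form_pos_def GT Gu (fun u => gram_mx_ge0 u Mp bA1).
have GiT : (invmx G)^T = invmx G by rewrite trmx_inv GT.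
(* [h a *m invmx G] is the coordinate vector of [a] in the basis [b], modulo the kernel. *)
pose h a : 'rV[R]_r := \row_t Y (a +m b t).
have hb s : h (b s) = row s G by apply/rowP => t; rewrite !mxE.
have YE a a' : in_mon A w.+1 a -> in_mon A w.+1 a' ->
    Y (a +m a') = (h a *m invmx G *m (h a')^T) 0 0.
  move=> aA a'A; have [c cE] := red a aA.
  have -> : h a = c *m G.
    by apply/rowP => t; rewrite !mxE cE//; apply: eq_bigr => s _; rewrite mxE.
  rewrite mulmxK// mxE cE//; apply: eq_bigr => t _.
  by rewrite !mxE addmC.
pose T k : 'M[R]_r := \matrix_(s, t) Y (m1 k +m b s +m b t).
have TT k : (T k)^T = T k.
  by apply/matrixP => s t; rewrite !mxE -!addmA (addmC (b s)).
have kbA k t : k \in A -> in_mon A w.+1 (m1 k +m b t).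
  by move=> kA; rewrite -add1n; apply: in_monD => //; exact: in_mon1.
have hT k s : h (m1 k +m b s) = row s (T k) by apply/rowP => t; rewrite !mxE.
have entry s t (X Z : 'M[R]_r) : (row s X *m col t Z) 0 0 = (X *m Z) s t.
  by rewrite colE mulmxA -row_mul -colE [LHS]mxE [LHS]mxE.
(* On the rows [h a], multiplication by the variable [k] is right multiplication by this matrix. *)
have hS k a : k \in A -> in_mon A w a -> h (m1 k +m a) = h a *m (invmx G *m T k).
  move=> kA aA; apply/rowP => t; rewrite mxE (addmC (m1 k)) -addmA.
  rewrite YE ?kbA// ?(in_mon_le _ aA)// hT mulmxA tr_row TT colE mulmxA -colE.
  by rewrite [LHS]mxE.
pose X k := invmx G *m T k.
have Xadj k : X k *m invmx G = invmx G *m (X k)^T.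
  by rewrite /X trmx_mul TT GiT !mulmxA.
have Gip (u : 'rV[R]_r) : u != 0 -> 0 < (u *m invmx G *m u^T) 0 0.
  move=> u0; have := Gp (u *m invmx G); rewrite trmx_mul GiT !mulmxA mulmxKV//.
  by apply; apply: contraNneq u0 => /(congr1 (mulmx^~ G)); rewrite mulmxKV// mul0mx => ->.
have TGT j k s t : j \in A -> k \in A ->
    (T j *m invmx G *m T k) s t = Y (m1 j +m b s +m (m1 k +m b t)).
  by move=> jA kA; rewrite YE ?kbA// !hT tr_row TT -row_mul entry.
(* The entries of [T j *m invmx G *m T k] are moments of a product in which [j] and [k] play
   symmetric roles. *)
have Xcomm j k : j \in A -> k \in A -> comm_mx (X j) (X k).
  move=> jA kA; rewrite /comm_mx /X !mulmxA -!(mulmxA (invmx G)); congr (_ *m _).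
  apply/matrixP => s t; rewrite !TGT//; congr Y.
  by apply/mnmP => i; rewrite !mnmDE; lia.
have [P Pu Pdiag] : codiagonalizable [seq X k | k <- enum A].
  apply/codiagonalizableP; split.
    move=> _ _ /mapP[j + ->] /mapP[k + ->]; rewrite !mem_enum.
    exact: Xcomm.
  by move=> _ /mapP[k _ ->]; exact: self_adjoint_diagonalizable GiT Gip (Xadj k).
(* The rows of [P] are joint left eigenvectors; the atom [s] collects the eigenvalues of row [s].
   Only the coordinates in [A] are meaningful. *)
pose x s k := (P *m X k *m invmx P) s s.
have PX k : k \in A -> P *m X k = diag_mx (\row_s x s k) *m P.
  move=> kA; apply: (canRL (mulmxKV Pu)); apply/matrixP => s t.
  rewrite [RHS]mxE [in RHS]mxE; have [<-//|st] := eqVneq s t.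
  have /allP/(_ (X k)) := Pdiag; rewrite map_f ?mem_enum// => /(_ isT).
  by move=> /(diagonalizable_forP _ Pu); exact.
(* [c s] is the coordinate of the image under [h] of the monomial 1 along [row s P], and [phi s] is
   its [invmx G]-inner product with [row s P]. The weight of atom [s] will be [c s * phi s]. *)
pose c s := (h (@mnm0 n) *m invmx P) 0 s.
pose phi s := (P *m invmx G *m (h (@mnm0 n))^T) s 0.
have hP a : in_mon A w.+1 a -> h a *m invmx P = \row_s (c s * mev (x s) a).
  move: a; apply: in_mon_ind => [|k a kA aA IH].
    by apply/rowP => s; rewrite [RHS]mxE mev0 mulr1.
  rewrite hS// -/(X k) -(mulmxA (h a)).
  have -> : X k *m invmx P = invmx P *m diag_mx (\row_s x s k).
    by apply: (canRL (mulKmx Pu)); rewrite mulmxA PX// mulmxK.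
  rewrite mulmxA IH mul_mx_diag; apply/rowP => s; rewrite !mxE mevD mev1.
  by rewrite mulrA mulrAC.
have gP a : in_mon A w.+1 a ->
    P *m invmx G *m (h a)^T = \col_s (mev (x s) a * phi s).
  move: a; apply: in_mon_ind => [|k a kA aA IH].
    by apply/colP => s; rewrite [RHS]mxE mev0 mul1r.
  rewrite hS// -/(X k) trmx_mul mulmxA -(mulmxA P) -Xadj mulmxA PX//.
  rewrite -!mulmxA (mulmxA P) IH mul_diag_mx; apply/colP => s; rewrite !mxE mevD mev1.
  by rewrite mulrA.
(* The factors [c t * mev (x t) (b u)] are the entries of [G *m invmx P], the inverse of
   [P *m invmx G]. This yields both [c s != 0] and the interpolating polynomials. *)
have dual s t : \sum_u (P *m invmx G) s u * (c t * mev (x t) (b u)) = (s == t)%:R.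
  have : (P *m invmx G *m (G *m invmx P)) s t = (s == t)%:R.
    by rewrite mulmxA mulmxKV// mulmxV// mxE.
  rewrite mxE => <-; apply: eq_bigr => u _; congr (_ * _).
  have := congr1 (fun Z : 'rV[R]_r => Z 0 t) (hP _ (bA1 u)).
  by rewrite hb -row_mul mxE => ->; rewrite mxE.
have c0 s : c s != 0.
  apply/eqP => cs0; have := dual s s; rewrite eqxx big1 => [/esym/eqP|u _].
    by rewrite oner_eq0.
  by rewrite cs0 mul0r mulr0.
have PE s u : P s u = mev (x s) (b u) * phi s.
  have := congr1 (fun Z : 'cV[R]_r => Z s 0) (gP _ (bA1 u)).
  rewrite hb tr_row GT colE mulmxA mulmxKV// -colE mxE => ->.
  by rewrite mxE.
(* Thus the weight is [c s ^+ 2] times the squared norm of an eigenvector, hence positive. *)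
have phiE s : phi s = c s * (row s P *m invmx G *m (row s P)^T) 0 0.
  have rowsE (Z : 'M[R]_r) u : row s Z 0 u = Z s u by rewrite mxE.
  have trE u : (row s P)^T u 0 = P s u by rewrite !mxE.
  have := dual s s; rewrite eqxx mulr1n => d1.
  rewrite -row_mul mxE mulr_sumr -[LHS]mul1r -d1 mulr_suml.
  by apply: eq_bigr => u _; rewrite rowsE trE PE; ring.
exists x, (fun s => c s * phi s); split.
- move=> s; rewrite phiE mulrA -expr2 mulr_gt0 ?exprn_even_gt0 ?c0//; apply: Gip.
  apply: contraTneq Pu => Ps0; rewrite unitmxE (expand_det_row _ s) big1 ?unitr0// => u _.
  by have /rowP/(_ u) := Ps0; rewrite !mxE => ->; rewrite mul0r.
- move=> a /in_mon_split[a1 [a2 [-> a1A a2A]]]; rewrite YE//.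
  rewrite -[h a1](mulmxKV Pu) hP// -2!mulmxA (mulmxA P) gP// mxE.
  by apply: eq_bigr => s _; rewrite !mxE mevD; ring.
- move=> s; exists (fun u => (P *m invmx G) s u * c s) => t.
  transitivity (c s / c t * (s == t)%:R).
    rewrite -dual mulr_sumr; apply: eq_bigr => u _.
    by field.
  by rewrite eq_sym; case: eqVneq => [->|_]; rewrite ?mulr0// mulr1 divff.
Qed.

End FlatExtension.

(** * Uniqueness of the marginal on a flat overlap *)

Section Marginals.
Variables (R : realType) (n : nat).
Implicit Types (A B U : {set 'I_n}) (a : multinom n) (p q : 'I_n -> R).

Definition agree A p q := [forall k in A, p k == q k].

Lemma agreeP A p q : reflect {in A, p =1 q} (agree A p q).
Proof. by apply: (iffP forall_inP) => E k kA; apply/eqP/E. Qed.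

Lemma agree_sym A p q : agree A p q = agree A q p.
Proof. by apply: eq_forallb_in => k _; rewrite eq_sym. Qed.

Lemma agree_trans A q p p' : agree A p q -> agree A q p' -> agree A p p'.
Proof. by move=> /agreeP E /agreeP E'; apply/agreeP => k kA; rewrite E ?E'. Qed.

Lemma agree_congr A p q p' : agree A p q -> agree A p' p = agree A p' q.
Proof.
move=> pq; apply/idP/idP => [E|E]; first exact: agree_trans E pq.
by rewrite agree_sym in pq; exact: agree_trans E pq.
Qed.

(** Atoms may coincide and weights may vanish, as happens after gluing; [merge_atoms] tidies this up
    at the end. *)
Definition atoms_represent (Y : multinom n -> R) A d (I : finType)
    (x : I -> 'I_n -> R) (l : I -> R) :=
  forall a, in_mon A d a -> Y a = \sum_i l i * mev (x i) a.

Variables (Y : multinom n -> R) (A : {set 'I_n}).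

(* A polynomial [p] orthogonal to all monomials of degree at most [w] satisfies
   [L(p^2) = 0], hence vanishes at all the atoms. *)
Lemma reduction_on_atoms w r (b : 'I_r -> multinom n) a (c : 'rV[R]_r)
    (I : finType) (x : I -> 'I_n -> R) (l : I -> R) :
  (forall t, in_mon A w (b t)) -> in_mon A w a ->
  (forall a', in_mon A w a' -> Y (a +m a') = \sum_t c 0 t * Y (b t +m a')) ->
  (forall i, 0 <= l i) -> atoms_represent Y A (w + w) x l ->
  forall i, l i != 0 -> mev (x i) a = \sum_t c 0 t * mev (x i) (b t).
Proof.
move=> bA aA red l0 rep.
pose p i := mev (x i) a - \sum_t c 0 t * mev (x i) (b t).
have orth a' : in_mon A w a' -> \sum_i l i * p i * mev (x i) a' = 0.
  move=> a'A; have := red _ a'A; rewrite rep ?in_monD// => /eqP.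
  rewrite -subr_eq0 => /eqP E; rewrite -[RHS]E.
  under [X in _ = _ - X]eq_bigr do rewrite rep ?in_monD// mulr_sumr.
  rewrite exchange_big -sumrB; apply: eq_bigr => i _ /=.
  rewrite /p mulrBr mulrBl mevD mulrA; congr (_ - _).
  by rewrite mulr_sumr mulr_suml; apply: eq_bigr => t _; rewrite mevD; ring.
have sq : \sum_i l i * p i ^+ 2 = 0.
  transitivity (\sum_i l i * p i * mev (x i) a -
                \sum_t c 0 t * \sum_i l i * p i * mev (x i) (b t)).
    under [X in _ = _ - X]eq_bigr do rewrite mulr_sumr.
    rewrite exchange_big -sumrB; apply: eq_bigr => i _ /=.
    rewrite expr2 {2}/p mulrBr mulrBr !mulrA; congr (_ - _).
    by rewrite mulr_sumr; apply: eq_bigr => t _; ring.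
  by rewrite orth// big1 ?subr0// => t _; rewrite orth// mulr0.
move=> i li; move/eqP: sq.
rewrite psumr_eq0 => [/allP/(_ i)|j _]; last by rewrite mulr_ge0 ?sqr_ge0.
rewrite mem_index_enum mulf_eq0 (negPf li) /= sqrf_eq0 /p subr_eq0.
by move=> /(_ isT)/eqP.
Qed.

(** Functions that coincide on the atoms with a combination of the [b t] have the same integral for
    both measures, and they are stable under multiplication by a variable in [A]. They therefore
    include polynomials of any degree, in particular one that isolates the class of [u]. *)
Lemma flat_marginal_unique w r (b : 'I_r -> multinom n)
    (I : finType) (x : I -> 'I_n -> R) (l : I -> R)
    (J : finType) (z : J -> 'I_n -> R) (mu : J -> R) :
  (forall t, in_mon A w (b t)) ->
  (forall a, in_mon A w.+1 a -> exists c : 'rV_r, forall a', in_mon A w.+1 a' ->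
     Y (a +m a') = \sum_t c 0 t * Y (b t +m a')) ->
  (forall i, 0 <= l i) -> atoms_represent Y A (w.+1 + w.+1) x l ->
  (forall j, 0 <= mu j) -> atoms_represent Y A (w.+1 + w.+1) z mu ->
  forall u, \sum_(i | agree A (x i) u) l i = \sum_(j | agree A (z j) u) mu j.
Proof.
move=> bA red l0 repx mu0 repz u.
have bA1 t : in_mon A w.+1 (b t) := in_mon_le (leqnSn w) (bA t).
have bA2 t : in_mon A (w.+1 + w.+1) (b t) by apply: in_mon_le (bA1 t); rewrite leq_addr.
pose expand (c : 'rV[R]_r) p := \sum_t c 0 t * mev p (b t).
(* One and the same [c] must serve the atoms of both measures. *)
pose reduced (f : ('I_n -> R) -> R) := exists c : 'rV[R]_r,
  (forall i, l i != 0 -> f (x i) = expand c (x i)) /\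
  (forall j, mu j != 0 -> f (z j) = expand c (z j)).
have reduced_mev a : in_mon A w.+1 a -> reduced (fun p => mev p a).
  move=> aA; have [c cE] := red a aA; exists c; split.
    exact: reduction_on_atoms bA1 aA cE l0 repx.
  exact: reduction_on_atoms bA1 aA cE mu0 repz.
have sum_expand (K : finType) (y : K -> 'I_n -> R) (m : K -> R) f c :
    atoms_represent Y A (w.+1 + w.+1) y m ->
    (forall k, m k != 0 -> f (y k) = expand c (y k)) ->
    \sum_k m k * f (y k) = \sum_t c 0 t * Y (b t).
  move=> rep fE; under [RHS]eq_bigr do rewrite rep// mulr_sumr.
  rewrite exchange_big; apply: eq_bigr => k _ /=.
  have [->|mk] := eqVneq (m k) 0.
    by rewrite mul0r big1// => t _; rewrite mul0r mulr0.
  by rewrite fE// mulr_sumr; apply: eq_bigr => t _; ring.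
have reduced_sum f : reduced f -> \sum_i l i * f (x i) = \sum_j mu j * f (z j).
  by move=> [c [fx fz]]; rewrite (sum_expand _ _ _ _ c repx)// (sum_expand _ _ _ _ c repz).
have reduced_mul f k d : k \in A -> reduced f -> reduced (fun p => f p * (p k - d)).
  move=> kA [c [fx fz]].
  (* Since [b t] has degree at most [w], its product with a variable can be reduced again. *)
  have kbA t : in_mon A w.+1 (m1 k +m b t).
    by rewrite -add1n; apply: in_monD => //; exact: in_mon1.
  have [C CE] := choice (fun t => reduced_mev _ (kbA t)).
  have expE p : (forall t, mev p (m1 k +m b t) = expand (C t) p) ->
      expand c p * (p k - d) = expand (\sum_t c 0 t *: C t - d *: c) p.
    move=> Cp; rewrite /expand.
    transitivity (\sum_t c 0 t * expand (C t) p - d * expand c p).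
      rewrite mulrBr (mulrC _ d); congr (_ - _); rewrite mulr_suml.
      by apply: eq_bigr => t _; rewrite -Cp mevD mev1; ring.
    rewrite /expand mulr_sumr; under eq_bigr do rewrite mulr_sumr.
    rewrite exchange_big -sumrB; apply: eq_bigr => t _ /=.
    rewrite !mxE summxE mulrBl mulr_suml mulrA; congr (_ - _).
    by apply: eq_bigr => s _; rewrite !mxE mulrA.
  exists (\sum_t c 0 t *: C t - d *: c); split=> [i li|j mj].
    by rewrite -expE ?fx// => t; exact: (CE t).1.
  by rewrite -expE ?fz// => t; exact: (CE t).2.
pose pt (k : I + J) := match k with inl i => x i | inr j => z j end.
(* For each atom of [s] that differs from [u] on [A], [f] gets a linear factor in a coordinate where
   they differ. *)
have separating (s : seq (I + J)) : exists f, [/\ reduced f, f u != 0,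
    forall p, agree A p u -> f p = f u &
    forall k, k \in s -> ~~ agree A (pt k) u -> f (pt k) = 0].
  elim: s => [|k s [f [rf fu fE f0]]].
    exists (fun p => mev p (@mnm0 n)); rewrite mev0 oner_neq0; split=> // [|p _].
      exact/reduced_mev/in_mon0.
    by rewrite mev0.
  have [ku|] := boolP (agree A (pt k) u).
    exists f; split=> // k'; rewrite inE => /predU1P[->|k's]; last exact: f0.
    by rewrite ku.
  rewrite negb_forall_in => /exists_inP[j jA kj].
  exists (fun p => f p * (p j - pt k j)); split.
  - exact: reduced_mul.
  - by rewrite mulf_neq0// subr_eq0 eq_sym.
  - by move=> p pu; rewrite fE// (agreeP _ _ _ pu).
  - move=> k'; rewrite inE => /predU1P[->|k's] k'u; first by rewrite subrr mulr0.
    by rewrite f0 ?mul0r.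
have [f [/reduced_sum fsum fu fE f0]] := separating (enum {: I + J}).
apply: (mulIf fu); rewrite !mulr_suml.
transitivity (\sum_i l i * f (x i)).
  rewrite big_mkcond; apply: eq_bigr => i _; case: ifPn => [/fE -> //|xu].
  by rewrite (f0 (inl i)) ?mem_enum ?mulr0.
rewrite fsum [RHS]big_mkcond; apply: eq_bigr => i _; case: ifPn => [/fE -> //|xu].
by rewrite (f0 (inr i)) ?mem_enum ?mulr0.
Qed.

End Marginals.

(** * Gluing two atomic measures with a common marginal *)

Section Gluing.
Variables (R : realType) (n : nat) (U B : {set 'I_n}).
Variables (I : finType) (x : I -> 'I_n -> R) (l : I -> R).
Variables (J : finType) (z : J -> 'I_n -> R) (mu : J -> R).
Hypotheses (l0 : forall i, 0 <= l i) (mu0 : forall j, 0 <= mu j).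
Hypothesis marginals : forall u : 'I_n -> R,
  \sum_(i | agree (U :&: B) (x i) u) l i = \sum_(j | agree (U :&: B) (z j) u) mu j.

Let overlap := @agree R n (U :&: B).
Let mass u := \sum_(j | overlap (z j) u) mu j.

(** On [U :&: B] the choice of the second component is harmless: the weight is 0 unless both
    components agree there. *)
Definition glued_point (p : I * J) : 'I_n -> R :=
  fun k => if k \in B then z p.2 k else x p.1 k.

(* The conditional product of the two measures over their common marginal. *)
Definition glued_weight (p : I * J) : R :=
  if overlap (x p.1) (z p.2) then l p.1 * mu p.2 / mass (x p.1) else 0.

Let mass_ge0 u : 0 <= mass u. Proof. exact: sumr_ge0. Qed.

Let mass_congr u v : overlap u v -> mass u = mass v.
Proof. by move=> uv; apply: eq_bigl => j; exact: agree_congr. Qed.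

Let massx_neq0 i : l i != 0 -> mass (x i) != 0.
Proof.
move=> li; rewrite gt_eqF// /mass -marginals (bigD1 i) /=; last exact/agreeP.
by rewrite ltr_pwDl ?sumr_ge0// lt_neqAle eq_sym li l0.
Qed.

Let massz_neq0 j : mu j != 0 -> mass (z j) != 0.
Proof.
move=> mj; rewrite gt_eqF// /mass (bigD1 j) /=; last exact/agreeP.
by rewrite ltr_pwDl ?sumr_ge0// lt_neqAle eq_sym mj mu0.
Qed.

Lemma glued_weight_ge0 p : 0 <= glued_weight p.
Proof. by rewrite /glued_weight; case: ifP => // _; rewrite !mulr_ge0 ?invr_ge0. Qed.

Lemma glued_weight_neq0 p : glued_weight p != 0 ->
  [/\ l p.1 != 0, mu p.2 != 0, {in U, glued_point p =1 x p.1} &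
      {in B, glued_point p =1 z p.2}].
Proof.
rewrite /glued_weight; case: ifPn => [/agreeP xz|_]; last by rewrite eqxx.
rewrite !mulf_eq0 !negb_or => /andP[/andP[lp mp] _]; split=> // k kU.
  by rewrite /glued_point; case: ifPn => // kB; rewrite xz// inE kU.
by rewrite /glued_point kU.
Qed.

Lemma glued_weight_fst f :
  \sum_p glued_weight p * f p.1 = \sum_i l i * f i.
Proof.
rewrite -(pair_bigA _ (fun i j => glued_weight (i, j) * f i)) /=.
apply: eq_bigr => i _; rewrite -mulr_suml /glued_weight /= -big_mkcond -mulr_suml.
rewrite -mulr_sumr (eq_bigl (fun j => overlap (z j) (x i))) => [|j]; last exact: agree_sym.
(* If [l i = 0] both sides vanish, even where [mass (x i)] is 0; otherwise the mass is nonzero and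
   cancels. *)
rewrite -/(mass _); have [->|/massx_neq0 mi] := eqVneq (l i) 0; first by rewrite !mul0r.
by rewrite mulfK.
Qed.

Lemma glued_weight_snd f :
  \sum_p glued_weight p * f p.2 = \sum_j mu j * f j.
Proof.
rewrite -(pair_bigA _ (fun i j => glued_weight (i, j) * f j)) exchange_big /=.
apply: eq_bigr => j _; rewrite -mulr_suml /glued_weight /= -big_mkcond.
(* The denominator becomes [mass (z j)], which [marginals] identifies with the sum of the [l i] over
   the compatible [i]. *)
under eq_bigr => i xz do rewrite (mass_congr xz).
rewrite -!mulr_suml marginals -/(mass _).
have [->|/massz_neq0 mj] := eqVneq (mu j) 0; first by rewrite mulr0 !mul0r.
by rewrite (mulrC (mass _)) mulfK.
Qed.

End Gluing.

(** * Clique polynomials and the Riesz functional *)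

Section LiftPoly.
Variables (R : realType) (n : nat) (A : {set 'I_n}).

(** The sum has at most one term, as [enum_val] is injective; it is empty for [k] outside [A]. *)
Definition lift_mnm (c : multinom #|A|) : multinom n :=
  Multinom [tuple (\sum_(i < #|A| | enum_val i == k) c i)%N | k < n].

Lemma in_mon_lift (c : multinom #|A|) : in_mon A (mdeg c) (lift_mnm c).
Proof.
apply/andP; split.
  apply/forallP => k; apply/implyP => kA; rewrite mnmE big1// => i /eqP ik.
  by rewrite -ik enum_valP in kA.
rewrite !mdegE; under eq_bigr do rewrite mnmE.
rewrite (exchange_big_dep xpredT)//= leq_sum// => i _.
by rewrite (big_pred1 (enum_val i))// => k; rewrite eq_sym.
Qed.

Lemma mev_lift (x : 'I_n -> R) (c : multinom #|A|) :
  mev x (lift_mnm c) = \prod_(i < #|A|) x (enum_val i) ^+ c i.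
Proof.
rewrite /mev; under eq_bigr do rewrite mnmE -prodrXr.
rewrite (exchange_big_dep xpredT)//=; apply: eq_bigr => i _.
by rewrite (big_pred1 (enum_val i))// => k; rewrite eq_sym.
Qed.

Lemma lift_polyE (g : mpoly #|A| R) :
  lift_poly g = \sum_(c <- msupp g) mcoeff c g *: mpolyX R (lift_mnm c).
Proof.
rewrite /lift_poly comp_mpolyE; apply: eq_bigr => c _; congr (_ *: _).
rewrite [RHS]mpolyXE_id; under eq_bigr do rewrite tnth_mktuple.
under [RHS]eq_bigr do rewrite mnmE -prodrXr.
rewrite (exchange_big_dep xpredT)//=; apply: eq_bigr => i _.
by rewrite (big_pred1 (enum_val i))// => k; rewrite eq_sym.
Qed.

End LiftPoly.

Section RieszFunctional.
Variables (R : realType) (n m : nat) (D : 'I_m -> {set 'I_n}) (w : nat).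
Variable y : {ffun cs_index D w -> R}.

(** Extends [y] to all monomials, by 0 outside the index set. *)
Definition moment (a : multinom n) : R := riesz y (mpolyX R a).

Lemma riesz_linear : linear (riesz y : mpoly n R -> R^o).
Proof.
move=> c p q; rewrite /riesz /= scaler_sumr -big_split; apply: eq_bigr => a _ /=.
by rewrite mcoeffD mcoeffZ mulrDl -mulrA.
Qed.

HB.instance Definition _ :=
  GRing.isLinear.Build R (mpoly n R) R^o _ (riesz y) riesz_linear.

Lemma moment_cs (a : cs_index D w) : moment (val (val a)) = y a.
Proof.
rewrite /moment /riesz (bigD1 a)//= mcoeffX eqxx mul1r big1 ?addr0// => b ba.
by rewrite mcoeffX eq_sym (inj_eq val_inj) (inj_eq val_inj) (negPf ba) mul0r.
Qed.

Lemma moment_mxE A d : moment_mx y A d = mnm_moment_mx moment A d.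
Proof. by apply/matrixP => p q; rewrite !mxE /moment mpolyXD. Qed.

Lemma riesz_lift_poly (A : {set 'I_n}) (g : mpoly #|A| R) (a b : multinom n) :
  riesz y (lift_poly g * mpolyX R a * mpolyX R b) =
  \sum_(c <- msupp g) mcoeff c g * moment (lift_mnm c +m a +m b).
Proof.
rewrite lift_polyE !mulr_suml linear_sum /=; apply: eq_bigr => c _.
by rewrite -!scalerAl linearZ /= /moment !mpolyXD.
Qed.

End RieszFunctional.

(** * Feasible atoms on one clique *)

Lemma col_form (R : comNzRingType) (r : nat) (M : 'M[R]_r) (v : 'I_r -> R) :
  ((\col_t v t)^T *m M *m \col_t v t) 0 0 = \sum_t \sum_u v t * M t u * v u.
Proof.
rewrite mxE exchange_big; apply: eq_bigr => u _ /=; rewrite [X in _ * X]mxE mxE.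
by rewrite mulr_suml; apply: eq_bigr => t _; rewrite !mxE.
Qed.

Section Cliques.
Variables (R : realType) (n m : nat) (D : 'I_m -> {set 'I_n}) (w : nat).
Variable y : {ffun cs_index D w.+1 -> R}.
Let Y := moment y.

(** Flatness down to degree [w.+1 - half_deg g] places the basis, hence the polynomial that is 1 at
    atom [s] and 0 at the others, within the index set of the localizing matrix. Its localizing form
    there is [l s] times the value of [g k] at the atom. *)
Lemma clique_measure (A : {set 'I_n}) (N : nat) (g : 'I_N -> mpoly #|A| R) :
  (max_deg g <= 2 * w.+1)%N -> psd (moment_mx y A w.+1) ->
  psd (localizing_mx y g) ->
  \rank (moment_mx y A w.+1) = \rank (moment_mx y A (w.+1 - half_deg g)) ->
  exists (r : nat) (x : 'I_r -> 'I_n -> R) (l : 'I_r -> R),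
    [/\ forall s, 0 <= l s, atoms_represent Y A (w.+1 + w.+1) x l &
        forall s k, 0 <= meval (fun j => x s (enum_val j)) (g k)].
Proof.
move=> gw Mp Lp; rewrite !moment_mxE in Mp * => rk.
have hw : (w.+1 - half_deg g <= w)%N.
  by rewrite leq_subLR -addn1 addnC leq_add2r leq_max.
have [r [b [bA bu red]]] := flat_basis (leq_subr _ _) rk.
have bAw t : in_mon A w (b t) := in_mon_le hw (bA t).
have [x [l [lp rep sep]]] := flat_extension Mp bAw bu red.
exists r, x, l; split=> // [s|s k]; first exact: ltW.
have [v vE] := sep s.
have bM t := cid (in_mon_monomials (bA t)).
pose f t := enum_rank (projT1 (bM t)).
have LE t u : localizing_block y (w.+1 - half_deg g) (g k) (f t) (f u) =
    \sum_s' l s' * meval (fun j => x s' (enum_val j)) (g k) *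
      mev (x s') (b t) * mev (x s') (b u).
  rewrite mxE !enum_rankK -(projT2 (bM t)) -(projT2 (bM u)) riesz_lift_poly.
  under [RHS]eq_bigr do rewrite mevalE mulr_sumr !mulr_suml.
  rewrite exchange_big /=; apply: eq_big_seq => c cg.
  (* The degree of [g k] is at most twice [half_deg g]; [c4] makes the truncated subtraction
     exact. *)
  have cA : in_mon A (w.+1 + w.+1) (lift_mnm c +m b t +m b u).
    apply: (@in_mon_le _ _ (mdeg c + (w.+1 - half_deg g) + (w.+1 - half_deg g))).
      have c1 : (mdeg c < mmeasure mdeg (g k))%N by exact: msize_mdeg_lt.
      have c2 : ((mmeasure mdeg (g k)).-1 <= max_deg g)%N.
        exact: (@leq_bigmax _ (fun k => (mmeasure mdeg (g k)).-1)).
      have c3 : (max_deg g <= (half_deg g).*2)%N.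
        by rewrite -leq_uphalf_double leq_maxr.
      have c4 : (half_deg g <= w.+1)%N.
        by rewrite geq_max /= leq_uphalf_double -mul2n.
      by lia.
    by do 2![apply: in_monD => //]; exact: in_mon_lift.
  rewrite [moment y _]rep// mulr_sumr; apply: eq_bigr => s' _.
  by rewrite !mevD mev_lift; ring.
(* A diagonal block is a principal submatrix of the localizing matrix. *)
have Bp : psd (localizing_block y (w.+1 - half_deg g) (g k)).
  rewrite -[localizing_block _ _ _](submxblock_diag
    (fun k => localizing_block y (w.+1 - half_deg g) (g k))).
  exact: psd_mxsub.
have [_ /(_ (\col_t v t))] := psd_mxsub f Bp.
suff -> : ((\col_t v t)^T *m mxsub f f (localizing_block y (w.+1 - half_deg g) (g k))
    *m \col_t v t) 0 0 = l s * meval (fun j => x s (enum_val j)) (g k).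
  by rewrite pmulr_rge0.
transitivity (\sum_s' l s' * meval (fun j => x s' (enum_val j)) (g k) *
    (\sum_t v t * mev (x s') (b t)) ^+ 2).
  rewrite col_form; under eq_bigr do under eq_bigr do rewrite mxE LE mulr_sumr mulr_suml.
  under eq_bigr do rewrite exchange_big /=.
  rewrite exchange_big; apply: eq_bigr => s' _ /=.
  rewrite expr2 mulr_suml mulr_sumr; apply: eq_bigr => t _.
  by rewrite !mulr_sumr; apply: eq_bigr => u _; ring.
rewrite (bigD1 s)//= vE eqxx expr1n mulr1 big1 ?addr0// => s' s's.
by rewrite vE (negPf s's) expr0n mulr0.
Qed.

End Cliques.

(** * Induction along the running intersection order *)

Section Chain.
Variables (R : realType) (n m : nat) (D : 'I_m -> {set 'I_n}) (w : nat).
Variables (Y : multinom n -> R) (feasible : 'I_m -> ('I_n -> R) -> Prop).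

(** One measure serving the cliques up to [k] is glued with a measure of clique [k.+1]. Feasibility
    passes to glued points because it depends only on the coordinates of its clique. *)
Lemma chain_measure : (0 < m)%N ->
  (forall i p q, {in D i, p =1 q} -> feasible i p -> feasible i q) ->
  (forall i, exists (r : nat) (x : 'I_r -> 'I_n -> R) (l : 'I_r -> R),
    [/\ forall s, 0 <= l s, atoms_represent Y (D i) (w.+1 + w.+1) x l &
        forall s, feasible i (x s)]) ->
  (forall i : 'I_m, (1 <= i)%N -> exists j : 'I_m,
     [/\ (j < i)%N,
         D i :&: (\bigcup_(k < m | (k < i)%N) D k) \subset D j &
         \rank (mnm_moment_mx Y (D i :&: D j) w.+1) =
         \rank (mnm_moment_mx Y (D i :&: D j) w)]) ->
  exists (I : finType) (x : I -> 'I_n -> R) (l : I -> R),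
    [/\ forall i, 0 <= l i,
        forall i, atoms_represent Y (D i) (w.+1 + w.+1) x l &
        forall p, l p != 0 -> forall i, feasible i (x p)].
Proof.
move=> m0 feas_congr cl rip.
suff step k : (k < m)%N -> exists (I : finType) (x : I -> 'I_n -> R) (l : I -> R),
    [/\ forall i, 0 <= l i,
        forall i : 'I_m, (i <= k)%N -> atoms_represent Y (D i) (w.+1 + w.+1) x l &
        forall p, l p != 0 -> forall i : 'I_m, (i <= k)%N -> feasible i (x p)].
  have := step m.-1; rewrite ltn_predL => /(_ m0)[I [x [l [l0 rep fe]]]].
  have le (i : 'I_m) : (i <= m.-1)%N by rewrite -ltnS prednK.
  by exists I, x, l; split=> // [i|p lp i]; [exact: rep | exact: fe].
elim: k => [|k IH] km.
  have [r [x [l [l0 rep fe]]]] := cl (Ordinal km).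
  exists 'I_r, x, l; split=> // [i|p _ i]; rewrite leqn0 => /eqP i0.
    by have -> : i = Ordinal km by exact: val_inj.
  by have -> : i = Ordinal km by exact: val_inj.
have [I [x [l [l0 repx fex]]]] := IH (ltnW km).
pose i0 := Ordinal km.
have [r [z [mu [mu0 repz fez]]]] := cl i0.
have [j [ji DU rk]] := rip i0 isT.
pose U := (\bigcup_(k < m | (k < i0)%N) D k)%SET.
have DiU (i : 'I_m) : (i <= k)%N -> D i \subset U.
  by move=> ik; exact: (finset.bigcup_sup i).
(* The overlap with the whole union is the overlap with the single earlier clique [D j], where
   flatness is assumed. *)
have UE : U :&: D i0 = D i0 :&: D j.
  apply/eqP; rewrite finset.eqEsubset finset.setIC finset.subsetI finset.subsetIl DU /=.
  by rewrite finset.setIS// DiU.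
have [s [b [bA _ red]]] := flat_basis (leqnSn w) rk.
have marg (u : 'I_n -> R) : \sum_(i | agree (U :&: D i0) (x i) u) l i =
    \sum_(t | agree (U :&: D i0) (z t) u) mu t.
  rewrite UE; apply: (flat_marginal_unique bA red) => // a.
    rewrite in_monI => /andP[_]; exact: repx.
  by rewrite in_monI => /andP[aA _]; exact: repz.
pose q := glued_point (D i0) x z; pose wt := glued_weight U (D i0) x l z mu.
have wtP p : wt p != 0 -> [/\ l p.1 != 0, mu p.2 != 0, {in U, q p =1 x p.1} &
    {in D i0, q p =1 z p.2}] by exact: glued_weight_neq0.
have split_le (i : 'I_m) : (i <= k.+1)%N -> (i <= k)%N \/ i = i0.
  rewrite leq_eqVlt => /predU1P[ik|]; last by left.
  by right; exact: val_inj.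
exists (I * 'I_r)%type, q, wt; split=> [p|i|p /wtP[lp _ qx qz] i] /=.
- exact: glued_weight_ge0.
- move=> /split_le[ik|->] a aA.
    rewrite (repx i)//.
    rewrite -(glued_weight_fst l0 marg (fun s => mev (x s) a)).
    (* Pairs of weight 0 are set aside, since their point need not agree with [x p.1] on [U]. *)
    apply: eq_bigr => p _; rewrite -/(wt p); have [->|/wtP[_ _ qx _]] := eqVneq (wt p) 0.
      by rewrite !mul0r.
    congr (_ * _); apply: (eq_mev aA) => k' k'D; rewrite qx//.
    exact: (fintype.subsetP (DiU i ik)).
  rewrite repz//.
  rewrite -(glued_weight_snd mu0 marg (fun s => mev (z s) a)).
  apply: eq_bigr => p _; rewrite -/(wt p); have [->|/wtP[_ _ _ qz]] := eqVneq (wt p) 0.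
    by rewrite !mul0r.
  by congr (_ * _); apply: (eq_mev aA) => k' k'D; rewrite qz.
- move=> /split_le[ik|->].
    apply: (feas_congr _ (x p.1)); last exact: fex.
    move=> k' k'D; rewrite qx//; exact: (fintype.subsetP (DiU i ik)).
  apply: (feas_congr _ (z p.2)); last exact: fez.
  by move=> k' k'D; rewrite qz.
Qed.

End Chain.

(** * From weighted points to a measure, and the rank bound *)

(** Only points of nonzero weight are kept, each once and with the total weight of its occurrences.
    The identity for all [f] says that the measure is unchanged. *)
Lemma merge_atoms (R : realType) (T : choiceType) (I : finType) (x : I -> T) (l : I -> R) :
  (forall i, 0 <= l i) ->
  exists (r : nat) (z : 'I_r -> T) (mu : 'I_r -> {posnum R}),
    [/\ injective z,
        forall s, exists2 i, l i != 0 & z s = x i &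
        forall f : T -> R, \sum_i l i * f (x i) = \sum_s (mu s)%:num * f (z s)].
Proof.
move=> l0; pose pts := undup [seq x i | i <- enum I & l i != 0].
pose z := tnth (in_tuple pts).
have zP s : exists2 i, l i != 0 & z s = x i.
  have : z s \in [seq x i | i <- enum I & l i != 0] by rewrite -mem_undup mem_tnth.
  by case/(@mapP I T x) => i; rewrite mem_filter => /andP[li _] zE; exists i.
have mu0 s : 0 < \sum_(i | x i == z s) l i.
  have [i li ->] := zP s; rewrite (bigD1 i)//= ltr_pwDl ?sumr_ge0//.
  by rewrite lt_neqAle eq_sym li l0.
exists (size pts), z, (fun s => PosNum (mu0 s)); split=> // [|f].
  by apply/tuple_uniqP; exact: undup_uniq.
under [RHS]eq_bigr do rewrite /= mulr_suml.
rewrite (exchange_big_dep xpredT)//=; apply: eq_bigr => i _.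
have [->|li] := eqVneq (l i) 0.
  by rewrite mul0r big1// => s _; rewrite mul0r.
have /tnthP[s xs] : x i \in in_tuple pts.
  by rewrite mem_undup map_f// mem_filter li mem_enum.
rewrite (big_pred1 s) => [|s']; first by rewrite xs.
rewrite xs eq_sym; apply: inj_eq; apply/tuple_uniqP; exact: undup_uniq.
Qed.

Section AtomicIntegral.
Variables (R : realType) (d : measure_display) (T : measurableType d).
Variables (r : nat) (x : 'I_r -> T) (l : 'I_r -> {posnum R}).

(** For nonnegative functions, integrate against a finite sum of scaled Dirac measures; in general,
    subtract the finite integrals of the positive and negative parts. *)
Lemma integral_atomic_measure (f : T -> R) : measurable_fun [set: T] f ->
  (\int[atomic_measure x l]_t (f t)%:E = (\sum_k (l k)%:num * f (x k))%:E)%E.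
Proof.
move=> mf.
have l_ge0 i : 0 <= (l i)%:num by [].
(* [msum] takes a family indexed by all naturals, here padded with the zero measure. *)
pose mu (k : nat) : {measure set T -> \bar R} :=
  if insub k is Some i then mscale (NngNum (l_ge0 i)) \d_(x i)
  else mzero.
have ge0E (h : T -> R) : measurable_fun [set: T] h -> (forall t, 0 <= h t) ->
    (\int[atomic_measure x l]_t (h t)%:E = (\sum_k (l k)%:num * h (x k))%:E)%E.
  move=> mh h0; have /measurable_EFinP mhE := mh.
  rewrite (@eq_measure_integral _ _ _ _ (msum mu r)) => [|A _ _].
    rewrite ge0_integral_measure_sum//; last by move=> t _; rewrite lee_fin.
    rewrite -sumEFin; apply: eq_bigr => k _; rewrite /mu valK.
    rewrite ge0_integral_mscale//; last by move=> t _; rewrite lee_fin.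
    by rewrite integral_dirac// diracT mul1e EFinM.
  by rewrite /= /atomic_measure; apply: eq_bigr => k _; rewrite /mu valK.
rewrite integralE; have -> : (fun t => (f t)%:E) = EFin \o f by [].
rewrite funerpos funerneg ge0E ?ge0E//.
- rewrite -EFinB -sumrB; congr (_%:E); apply: eq_bigr => k _.
  by rewrite -mulrBr -[in RHS](funrposBneg f).
- exact: measurable_funrneg.
- exact: measurable_funrpos.
Qed.

End AtomicIntegral.

Lemma measurable_monom_eval (R : realType) (n : nat) (a : multinom n) :
  measurable_fun [set: euclid R n] (fun x => monom_eval x a).
Proof.
apply: measurable_prod => k _; apply: measurable_funX.
exact: measurable_tnth.
Qed.

(** With [V] the Vandermonde-like matrix of monomial values at the atoms, the moment matrix factors
    through dimension [r]. *)
Lemma rank_moment_mx_le (R : realType) (n m : nat) (D : 'I_m -> {set 'I_n})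
    (w : nat) (y : {ffun cs_index D w -> R}) (A : {set 'I_n}) (r : nat)
    (x : 'I_r -> 'I_n -> R) (l : 'I_r -> R) :
  atoms_represent (moment y) A (w + w) x l -> (\rank (moment_mx y A w) <= r)%N.
Proof.
move=> rep.
pose V := \matrix_(p < #|monomials A w|, s < r) mev (x s) (val (val (enum_val p))).
have -> : moment_mx y A w = V *m (diag_mx (\row_s l s) *m V^T).
  rewrite moment_mxE; apply/matrixP => p q; rewrite mul_diag_mx mxE rep.
    by rewrite mxE; apply: eq_bigr => s _; rewrite !mxE mevD; ring.
  by apply: in_monD; exact: monomials_in_mon.
exact: mulmx_max_rank.
Qed.

(** * Assembly: clique measures, gluing, merging, integration *)

Theorem theorem1p1 (R : realType) (n m : nat) (D : 'I_m -> {set 'I_n})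
    (N : 'I_m -> nat) (g : forall i : 'I_m, 'I_(N i) -> mpoly #|D i| R)
    (w : nat) (y : {ffun cs_index D w -> R}) :
  (1 <= n)%N -> (1 <= m)%N ->
  \bigcup_(i < m) D i = [set: 'I_n]%SET ->
  (forall i j : 'I_m, i != j -> ~~ (D i \subset D j)) ->
  (maxn 1 (\max_(i < m) max_deg (g i)) <= 2 * w)%N ->
  y != 0 ->
  (* (a) *)
  (forall i : 'I_m, (1 <= i)%N -> exists j : 'I_m, (j < i)%N /\
     D i :&: (\bigcup_(k < m | (k < i)%N) D k) \subset D j) ->
  (* (b) *)
  (forall i : 'I_m,
     [/\ psd (moment_mx y (D i) w),
         psd (localizing_mx y (g i)) &
         \rank (moment_mx y (D i) w) =
         \rank (moment_mx y (D i) (w - half_deg (g i)))]) ->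
  (forall i : 'I_m, (1 <= i)%N -> exists j : 'I_m,
     [/\ (j < i)%N,
         D i :&: (\bigcup_(k < m | (k < i)%N) D k) \subset D j &
         \rank (moment_mx y (D i :&: D j) w) =
         \rank (moment_mx y (D i :&: D j) (w - 1))]) ->
  exists (r : nat) (x : 'I_r -> euclid R n) (l : 'I_r -> {posnum R}),
    [/\ (\max_(i < m) \rank (moment_mx y (D i) w) <= r)%N,
        injective x,
        forall k : 'I_r, feasible_set g (x k),
        represents y (atomic_measure x l) &
        forall a : cs_index D w,
          y a = \sum_(k < r) (l k)%:num * monom_eval (x k) (val (val a))].
Proof.
move=> _ m0 _ _ + _ _; rewrite geq_max => /andP[w0 gw] cliq rip.
(* From [1 <= 2 * w] the order is a successor, the form used by the flatness lemmas. *)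
case: w w0 y gw cliq rip => [//|w] _ y gw cliq rip.
pose feasible i (p : 'I_n -> R) :=
  forall k, 0 <= meval (fun j => p (enum_val j)) (g i k).
have [i p q pq pF k|i|i i1|I [x [l [l0 rep fe]]]] := @chain_measure R n m D w (moment y) feasible m0.
- rewrite (@meval_eq _ _ _ (fun j => p (enum_val j)))// => j.
  by rewrite pq// enum_valP.
- have [Mp Lp rk] := cliq i; apply: clique_measure Mp Lp rk.
  by apply: leq_trans gw; exact: (@leq_bigmax _ (fun i => max_deg (g i))).
- by have [j [ji DU rk]] := rip i i1; exists j; split=> //; rewrite -!moment_mxE rk subn1.
have [r [z [mu [zinj zx zsum]]]] :=
  merge_atoms (fun i => [tuple x i k | k < n] : euclid R n) l0.
have meE p a : monom_eval [tuple x p k | k < n] a = mev (x p) a.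
  by apply: eq_bigr => k _; rewrite tnth_mktuple.
(* The merged measure still represents every clique; each index of [y] lies in some clique, which
   gives [yE]. *)
have rep' i : atoms_represent (moment y) (D i) (w.+1 + w.+1) (fun s => tnth (z s))
    (fun s => (mu s)%:num).
  move=> a aD; rewrite (rep i a aD) -(zsum (fun p => monom_eval p a)).
  by apply: eq_bigr => p _; rewrite meE.
have yE (a : cs_index D w.+1) :
    y a = \sum_(k < r) (mu k)%:num * monom_eval (z k) (val (val a)).
  have [i ai] := existsP (valP a); rewrite -moment_cs (rep' i)//.
  by rewrite /in_mon ai addnn -mul2n -ltnS bmdeg.
exists r, z, mu; split=> //.
- by apply/bigmax_leqP => i _; exact: rank_moment_mx_le (rep' i).
- move=> k i j; have [p lp ->] := zx k; have := fe p lp i j.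
  rewrite (@meval_eq _ _ _ (tnth (subvec (D i) [tuple x p k | k < n])))// => t.
  by rewrite !tnth_mktuple.
- move=> a; rewrite (integral_atomic_measure z mu (measurable_monom_eval _)).
  by rewrite -yE.
Qed.
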